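(* Let $\mathcal E$ be the pattern of vertices of equilateral triangles in $\mathbb R^2$. Then for every positive integer $n$, \[ S_{\mathcal E}(n) \le \left\lfloor \frac{(4n-1)(n-1)}{18} \right\rfloor . \]
   Context: Identify $\mathbb R^2$ with $\mathbb C$. $\mathcal E$ is the set of all $3$-element subsets $\{a,b,c\}\subseteq\mathbb C$ whose three pairwise distances are equal (vertex sets of equilateral triangles). For a finite $V\subseteq\mathbb C$, $S_{\mathcal E}(V)$ is the number of sets $P\in\mathcal E$ with $P\subseteq V$, and $S_{\mathcal E}(n)=\max\{S_{\mathcal E}(V): V\subseteq \mathbb C,\ |V|=n\}$, the maximum number of equilateral triangles whose vertices all lie in an $n$-point subset of the plane. *)

(* Defs.v *)
From Stdlib Require Import Reals List Arith.
Import ListNotations.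
Open Scope R_scope.

Definition pt : Type := (R * R)%type.

Definition dist (p q : pt) : R :=
  sqrt ((fst p - fst q) ^ 2 + (snd p - snd q) ^ 2).

Definition equilateral (a b c : pt) : Prop :=
  dist a b = dist b c /\ dist b c = dist c a.

Definition equilateralb (a b c : pt) : bool :=
  if Req_EM_T (dist a b) (dist b c) then
    if Req_EM_T (dist b c) (dist c a) then true else false
  else false.

Lemma equilateralb_spec a b c : equilateralb a b c = true <-> equilateral a b c.
Proof.
  unfold equilateralb, equilateral.
  destruct (Req_EM_T (dist a b) (dist b c)); destruct (Req_EM_T (dist b c) (dist c a));
  split; intros H; try discriminate; try tauto; destruct H; contradiction.
Qed.

(* All pairs / triples of entries of a list at strictly increasing positions.
   For a duplicate-free list V these are in bijection with the 2- resp.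
   3-element subsets of the finite set V. *)
Fixpoint pairs (l : list pt) : list (pt * pt) :=
  match l with
  | [] => []
  | a :: t => map (fun b => (a, b)) t ++ pairs t
  end.

Fixpoint triples (l : list pt) : list (pt * pt * pt) :=
  match l with
  | [] => []
  | a :: t => map (fun bc => (a, fst bc, snd bc)) (pairs t) ++ triples t
  end.

(* S_E(V): number of 3-element subsets {a,b,c} of V that are vertex sets of
   equilateral triangles (V given as a duplicate-free list). *)
Definition S_E (V : list pt) : nat :=
  length (filter (fun t => match t with (a, b, c) => equilateralb a b c end)
                 (triples V)).

(* Main.v *)
Require Import Defs.
From Stdlib Require Import Reals Lra Lia ZArith List Arith Permutation Bool.
Import ListNotations.

(* Write N = n - 1.  Around each point v of V cut the plane into six half-open sextants; the rotation
   by 60 degrees about v maps each sextant to the next, so the number of x in V whose image is again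
   in V is at most the sum of min(s_i, s_(i+1)), where s_i counts the points of V in sextant i.  These
   numbers of pairs (v, x) add up to at least three times the number of triangles.
   Three consecutive sextants form a half-plane, and "w lies in this half-plane of v" is a strict
   total order on V.  Thus p_1 = s_0 + s_1 + s_2, p_2 = s_5 + s_0 + s_1, p_3 = s_4 + s_5 + s_0 are
   ranks, each taking every value 0, ..., N once as v runs over V.  A suitable G with
   36 * (sum of min(s_i, s_(i+1))) <= G(p_1) + G(p_2) + G(p_3) and G(0) + ... + G(N) <= 8 N^2 + 6 N
   gives 36 S <= 8 N^2 + 6 N, that is 18 S <= (4 n - 1) (n - 1). *)

Local Open Scope nat_scope.

(** * Sums of natural numbers over lists *)

Definition sumn {A : Type} (f : A -> nat) (l : list A) : nat := list_sum (map f l).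

Lemma sumn_app A (f : A -> nat) l m : sumn f (l ++ m) = sumn f l + sumn f m.
Proof. unfold sumn. now rewrite map_app, list_sum_app. Qed.

Lemma sumn_cons A (f : A -> nat) a l : sumn f (a :: l) = f a + sumn f l.
Proof. reflexivity. Qed.

Lemma sumn_map A B (g : A -> B) (f : B -> nat) l : sumn f (map g l) = sumn (fun x => f (g x)) l.
Proof. unfold sumn. now rewrite map_map. Qed.

Lemma sumn_le A (f g : A -> nat) l :
  (forall x, In x l -> f x <= g x) -> sumn f l <= sumn g l.
Proof.
  induction l as [|a l IH]; intros H; [reflexivity|]. rewrite !sumn_cons.
  pose proof (H a (or_introl eq_refl)). pose proof (IH (fun x i => H x (or_intror i))). lia.
Qed.

Lemma sumn_ext A (f g : A -> nat) l :
  (forall x, In x l -> f x = g x) -> sumn f l = sumn g l.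
Proof.
  intros H. apply Nat.le_antisymm; apply sumn_le; intros x Hx; rewrite (H x Hx); reflexivity.
Qed.

Lemma sumn_add A (f g : A -> nat) l :
  sumn (fun x => f x + g x) l = sumn f l + sumn g l.
Proof. induction l as [|a l IH]; [reflexivity|]. rewrite !sumn_cons, IH. lia. Qed.

Lemma sumn_mul A (f : A -> nat) c l : sumn (fun x => c * f x) l = c * sumn f l.
Proof. induction l as [|a l IH]; [unfold sumn; simpl; lia|]. rewrite !sumn_cons, IH. lia. Qed.

Lemma sumn_const A c (l : list A) : sumn (fun _ => c) l = c * length l.
Proof. induction l as [|a l IH]; [unfold sumn; simpl; lia|]. rewrite sumn_cons, IH. simpl; lia. Qed.

Lemma sumn_exchange A B (f : A -> B -> nat) l m :
  sumn (fun x => sumn (f x) m) l = sumn (fun y => sumn (fun x => f x y) l) m.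
Proof.
  induction l as [|a l IH].
  - unfold sumn at 1; simpl. symmetry. erewrite sumn_ext; [apply (sumn_const _ 0)|]. reflexivity.
  - rewrite sumn_cons, IH, <- sumn_add. reflexivity.
Qed.

Lemma sumn_perm A (f : A -> nat) l m : Permutation l m -> sumn f l = sumn f m.
Proof. induction 1; rewrite ?sumn_cons; try lia; reflexivity. Qed.

Lemma sumn_b2n_le1 A (P : A -> bool) l : NoDup l ->
  (forall x y, P x = true -> P y = true -> x = y) -> sumn (fun x => Nat.b2n (P x)) l <= 1.
Proof.
  intros D U. induction D as [|a l Ha D IH]; [unfold sumn; simpl; lia|].
  rewrite sumn_cons. destruct (P a) eqn:Pa; [|simpl; lia].
  rewrite (sumn_ext _ _ (fun _ => 0)); [rewrite sumn_const; simpl; lia|].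
  intros x Hx. destruct (P x) eqn:Px; [|reflexivity].
  now rewrite (U x a Px Pa) in Hx.
Qed.

Lemma length_filter_sumn A (P : A -> bool) l : length (filter P l) = sumn (fun x => Nat.b2n (P x)) l.
Proof. induction l as [|a l IH]; [reflexivity|]. rewrite sumn_cons; simpl. destruct (P a); simpl; lia. Qed.

(** * Ranks in a strict total order *)

Definition rank {A} (lt : A -> A -> bool) (l : list A) (v : A) : nat :=
  sumn (fun w => Nat.b2n (lt v w)) l.

(** Ranks strictly decrease along [lt], so by totality distinct elements have distinct ranks. No
    element counts itself, so all ranks are below [length l] and fill [seq 0 (length l)]. *)
Lemma sumn_rank A (lt : A -> A -> bool) (f : nat -> nat) l : NoDup l ->
  (forall x, lt x x = false) ->
  (forall x y z, lt x y = true -> lt y z = true -> lt x z = true) ->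
  (forall x y, lt x y = false -> lt y x = false -> x = y) ->
  sumn (fun v => f (rank lt l v)) l = sumn f (seq 0 (length l)).
Proof.
  intros D Irr Tr Tot.
  assert (Mono : forall v w m, lt v w = true -> rank lt m w <= rank lt m v).
  { intros v w m vw. apply sumn_le; intros z _.
    destruct (lt w z) eqn:wz; [rewrite (Tr _ _ _ vw wz)|]; simpl; lia. }
  assert (SMono : forall v w m, In w m -> lt v w = true -> rank lt m w < rank lt m v).
  { intros v w m. induction m as [|a m IH]; [contradiction|]. intros [->|i] vw.
    - unfold rank; rewrite !sumn_cons. specialize (Mono v w m vw). unfold rank in Mono.
      rewrite Irr, vw; simpl; lia.
    - specialize (IH i vw). unfold rank in *; rewrite !sumn_cons.
      destruct (lt w a) eqn:wa; [rewrite (Tr _ _ _ vw wa)|]; simpl; lia. }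
  rewrite <- (sumn_map _ _ (rank lt l) f). apply sumn_perm.
  apply NoDup_Permutation_bis.
  - apply NoDup_map_NoDup_ForallPairs; [|exact D].
    intros x y Hx Hy E. destruct (lt x y) eqn:xy; [specialize (SMono x y l Hy xy); lia|].
    destruct (lt y x) eqn:yx; [specialize (SMono y x l Hx yx); lia|].
    now apply Tot.
  - now rewrite length_map, length_seq.
  - intros k Hk. apply in_map_iff in Hk as [v [<- Hv]]. apply in_seq. split; [lia|]. simpl.
    apply Nat.lt_le_trans with (m := sumn (fun _ => 1) l); [|rewrite sumn_const; lia].
    clear D SMono Mono. unfold rank. induction l as [|a l IH]; [contradiction|]. rewrite !sumn_cons.
    assert (L : sumn (fun w => Nat.b2n (lt v w)) l <= sumn (fun _ => 1) l)
      by (apply sumn_le; intros; destruct (lt v x); simpl; lia).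
    destruct Hv as [->|Hv]; [rewrite Irr|specialize (IH Hv); destruct (lt v a)]; simpl; lia.
Qed.

(** * Ordered against unordered pairs and triples *)

Lemma pairs_sumn (h : pt -> pt -> nat) l :
  sumn (fun p => h (fst p) (snd p) + h (snd p) (fst p)) (pairs l) <=
  sumn (fun x => sumn (h x) l) l.
Proof.
  induction l as [|a l IH]; [reflexivity|]. simpl pairs.
  rewrite sumn_app, sumn_map, sumn_cons, sumn_cons. simpl fst; simpl snd.
  rewrite sumn_add.
  rewrite (sumn_ext _ (fun x => sumn (h x) (a :: l)) (fun x => h x a + sumn (h x) l))
    by (intros; apply sumn_cons).
  rewrite sumn_add in IH. rewrite !sumn_add. lia.
Qed.

(** The right side contains all six orderings of each triple. The terms with the head [a] in exactly
    one position are handled by [pairs_sumn], applied to the sum of [f] over the three positions of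
    [a]. *)
Lemma triples_sumn (f : pt -> pt -> pt -> nat) l :
  sumn (fun t => match t with (a, b, c) =>
     f a b c + f b c a + f c a b + f a c b + f c b a + f b a c end) (triples l) <=
  sumn (fun x => sumn (fun y => sumn (f x y) l) l) l.
Proof.
  induction l as [|a l IH]; [reflexivity|]. simpl triples.
  rewrite sumn_app, sumn_map.
  pose proof (pairs_sumn (fun x y => f a x y + f x y a + f y a x) l) as P.
  rewrite (sumn_ext _ (fun x : pt * pt => f a (fst x) (snd x) + f (fst x) (snd x) a + f (snd x) a (fst x)
     + f a (snd x) (fst x) + f (snd x) (fst x) a + f (fst x) a (snd x))
     (fun p => (f a (fst p) (snd p) + f (fst p) (snd p) a + f (snd p) a (fst p)) +
      (f a (snd p) (fst p) + f (snd p) (fst p) a + f (fst p) a (snd p)))) by (intros; lia).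
  rewrite (sumn_ext _ _ (fun x => sumn (f a x) l + sumn (fun y => f x y a) l + sumn (fun y => f y a x) l)) in P.
  2:{ intros; rewrite !sumn_add; lia. }
  rewrite !sumn_add in P. 
  rewrite (sumn_exchange _ _ (fun x y => f y a x)) in P.
  rewrite sumn_cons, sumn_cons, sumn_cons.
  rewrite (sumn_ext _ (fun y => sumn (f a y) (a :: l)) (fun y => f a y a + sumn (f a y) l))
    by (intros; apply sumn_cons).
  rewrite (sumn_ext _ (fun x => sumn (fun y => sumn (f x y) (a :: l)) (a :: l))
    (fun x => (f x a a + sumn (f x a) l) + (sumn (fun y => f x y a) l + sumn (fun y => sumn (f x y) l) l))).
  2:{ intros. rewrite !sumn_cons, <- sumn_add. f_equal. }
  change (sumn (fun y => sumn (fun x => f y a x) l) l) with (sumn (fun x => sumn (f x a) l) l) in P.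
  rewrite !sumn_add. lia.
Qed.

(** * The weight function *)

(* [36 N g(j / N)] for the piecewise linear function [g] on [0, 1], symmetric about 1/2: constant 1/9 up
   to 1/18, slope 1/2 up to 5/18, slope 1 up to 7/18, then constant 1/3.  It is an optimal dual
   solution of the linear programme bounding the average degree by the ranks.
   The additions come first so that the truncated subtractions never lose anything. *)
Definition weight (N j : nat) : nat :=
  4 * N + (18 * j - N) + (18 * j - 5 * N) + (18 * j - 13 * N) + (18 * j - 17 * N)
  - 2 * (18 * j - 7 * N) - 2 * (18 * j - 11 * N).

(** [weight] is convex on either side of its middle plateau, so there each affine piece is a lower
    bound. *)
Lemma weight_cases N p : p <= N ->
  let g := weight N p in
  (18 * p <= 7 * N /\ 4 * N <= g /\ 3 * N + 18 * p <= g /\ 36 * p <= g + 2 * N) \/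
  (7 * N <= 18 * p <= 11 * N /\ 12 * N <= g) \/
  (11 * N <= 18 * p /\ 4 * N <= g /\ 21 * N <= g + 18 * p /\ 34 * N <= g + 36 * p).
Proof.
  unfold weight; intros Hp; cbv zeta.
  destruct (le_lt_dec (18 * p) (7 * N)); [left | destruct (le_lt_dec (18 * p) (11 * N)); right; [left | right]]; lia.
Qed.

(* Here [s_i] are the sizes of the six sextants around a point and [e_i] counts pairs of points
   matched by the rotation from sextant [i] to sextant [i + 1]. *)
Lemma sextant_bound s0 s1 s2 s3 s4 s5 e0 e1 e2 e3 e4 e5 N :
  N = s0 + s1 + s2 + s3 + s4 + s5 ->
  e0 <= s0 -> e0 <= s1 -> e1 <= s1 -> e1 <= s2 -> e2 <= s2 -> e2 <= s3 ->
  e3 <= s3 -> e3 <= s4 -> e4 <= s4 -> e4 <= s5 -> e5 <= s5 -> e5 <= s0 ->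
  36 * (e0 + e1 + e2 + e3 + e4 + e5) <=
  weight N (s0 + s1 + s2) + weight N (s5 + s0 + s1) + weight N (s4 + s5 + s0).
Proof.
  intros.
  pose proof (weight_cases N (s0 + s1 + s2)) as C1.
  pose proof (weight_cases N (s5 + s0 + s1)) as C2.
  pose proof (weight_cases N (s4 + s5 + s0)) as C3.
  cbv zeta in *.
  (* With the weights turned into variables, each of the 27 cases is a linear problem without
     truncated subtraction. *)
  generalize dependent (weight N (s0 + s1 + s2)).
  generalize dependent (weight N (s5 + s0 + s1)).
  generalize dependent (weight N (s4 + s5 + s0)).
  intros g3 C3 g2 C2 g1 C1.
  specialize (C1 ltac:(lia)); specialize (C2 ltac:(lia)); specialize (C3 ltac:(lia)).
  destruct C1 as [C1|[C1|C1]], C2 as [C2|[C2|C2]], C3 as [C3|[C3|C3]]; lia.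
Qed.

(** * Summing the weights by discrete antiderivatives *)

Local Open Scope Z_scope.

(* Discrete antiderivatives for steps of 18: up to the factor 36, [up_potential] has increments at
   least the positive part, [low_potential] at most.  The convex and the concave kinks of [weight]
   need these opposite bounds. *)
Definition up_potential (x : Z) : Z := (Z.max 0 (x - 9)) ^ 2.

Definition low_potential (x : Z) : Z := Z.max 0 x * (x - 18).

(** Equality for [9 <= x]; for [0 <= x < 9] the claim amounts to [0 <= (x - 9) ^ 2]. *)
Lemma up_potential_step x : 36 * Z.max 0 x <= up_potential (x + 18) - up_potential x.
Proof.
  unfold up_potential.
  destruct (Z.max_spec 0 x) as [[? ->]|[? ->]], (Z.max_spec 0 (x - 9)) as [[? ->]|[? ->]],
    (Z.max_spec 0 (x + 18 - 9)) as [[? ->]|[? ->]]; nia.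
Qed.

Lemma low_potential_step x : low_potential (x + 18) - low_potential x <= 36 * Z.max 0 x.
Proof.
  unfold low_potential.
  destruct (Z.max_spec 0 x) as [[? ->]|[? ->]], (Z.max_spec 0 (x + 18)) as [[? ->]|[? ->]]; nia.
Qed.

Definition potential (N x : Z) : Z :=
  up_potential (x - N) + up_potential (x - 5 * N) + up_potential (x - 13 * N)
  + up_potential (x - 17 * N)
  - 2 * low_potential (x - 7 * N) - 2 * low_potential (x - 11 * N).

Lemma weight_potential (N j : nat) : (j <= N)%nat ->
  36 * Z.of_nat (weight N j) <=
  144 * Z.of_nat N + potential (Z.of_nat N) (18 * Z.of_nat (S j))
                   - potential (Z.of_nat N) (18 * Z.of_nat j).
Proof.
  intros Hj.
  set (x := 18 * Z.of_nat j); set (n := Z.of_nat N).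
  replace (18 * Z.of_nat (S j)) with (x + 18) by lia.
  assert (E : Z.of_nat (weight N j) =
     4 * n + Z.max 0 (x - n) + Z.max 0 (x - 5 * n) + Z.max 0 (x - 13 * n)
     + Z.max 0 (x - 17 * n) - 2 * Z.max 0 (x - 7 * n) - 2 * Z.max 0 (x - 11 * n)).
  { unfold weight; subst x n; lia. }
  unfold potential.
  pose proof (up_potential_step (x - n)). pose proof (up_potential_step (x - 5 * n)).
  pose proof (up_potential_step (x - 13 * n)). pose proof (up_potential_step (x - 17 * n)).
  pose proof (low_potential_step (x - 7 * n)). pose proof (low_potential_step (x - 11 * n)).
  replace (x + 18 - n) with (x - n + 18) by ring.
  replace (x + 18 - 5 * n) with (x - 5 * n + 18) by ring.
  replace (x + 18 - 13 * n) with (x - 13 * n + 18) by ring.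
  replace (x + 18 - 17 * n) with (x - 17 * n + 18) by ring.
  replace (x + 18 - 7 * n) with (x - 7 * n + 18) by ring.
  replace (x + 18 - 11 * n) with (x - 11 * n + 18) by ring.
  lia.
Qed.

Lemma sum_weight_potential (N k : nat) : (k <= S N)%nat ->
  36 * Z.of_nat (sumn (weight N) (seq 0 k)) <=
  144 * Z.of_nat N * Z.of_nat k + potential (Z.of_nat N) (18 * Z.of_nat k)
                                - potential (Z.of_nat N) 0.
Proof.
  induction k as [|k IH]; intros Hk.
  - cbn [seq sumn map list_sum fold_right Z.of_nat]. rewrite !Z.mul_0_r. simpl. lia.
  - rewrite seq_S, sumn_app.
    replace (sumn (weight N) [0 + k]%nat) with (weight N k) by (unfold sumn; simpl; lia).
    pose proof (weight_potential N k ltac:(lia)). specialize (IH ltac:(lia)).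
    rewrite Nat2Z.inj_add. nia.
Qed.

Lemma sum_weight (N : nat) : (sumn (weight N) (seq 0 (S N)) <= 8 * N * N + 6 * N)%nat.
Proof.
  (* The telescoped potentials give the bound [8 N^2 + 4 N + 9], which suffices exactly when
     [N >= 5]; smaller [N] are evaluated. *)
  destruct (le_lt_dec 5 N) as [HN|HN].
  - pose proof (sum_weight_potential N (S N) ltac:(lia)) as H.
    assert (P0 : potential (Z.of_nat N) 0 = 0).
    { unfold potential, up_potential, low_potential. rewrite !Z.max_l by lia. ring. }
    set (n := Z.of_nat N) in *.
    assert (P1 : potential n (18 * Z.of_nat (S N)) =
       (17 * n + 9) ^ 2 + (13 * n + 9) ^ 2 + (5 * n + 9) ^ 2 + (n + 9) ^ 2
       - 2 * ((11 * n + 18) * (11 * n)) - 2 * ((7 * n + 18) * (7 * n))).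
    { unfold potential, up_potential, low_potential.
      replace (18 * Z.of_nat (S N)) with (18 * n + 18) by lia.
      rewrite !Z.max_r by lia. ring. }
    rewrite P0, P1 in H. nia.
  - do 5 (destruct N as [|N]; [vm_compute; repeat constructor|]). lia.
Qed.

(* Rotation by 60 degrees *)
Local Close Scope Z_scope.
Local Open Scope R_scope.

Definition vadd (p q : pt) : pt := (fst p + fst q, snd p + snd q).

Definition vsub (p q : pt) : pt := (fst p - fst q, snd p - snd q).

(** Multiplication by $\omega = e^{i\pi/3}$; what follows rests on $\omega = 1 + \omega^2$ and
    $\omega^3 = -1$. *)
Definition rot (u : pt) : pt :=
  (fst u / 2 - sqrt 3 / 2 * snd u, sqrt 3 / 2 * fst u + snd u / 2).

Definition rot_about (v x : pt) : pt := vadd v (rot (vsub x v)).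

Lemma pt_eq (p q : pt) : fst p = fst q -> snd p = snd q -> p = q.
Proof. destruct p, q; simpl; congruence. Qed.

Definition pt_eqb (p q : pt) : bool :=
  if Req_EM_T (fst p) (fst q) then if Req_EM_T (snd p) (snd q) then true else false
  else false.

Lemma pt_eqb_true p q : pt_eqb p q = true <-> p = q.
Proof.
  unfold pt_eqb.
  destruct (Req_EM_T (fst p) (fst q)), (Req_EM_T (snd p) (snd q));
    split; intros H; subst; try discriminate; try congruence.
  now apply pt_eq.
Qed.

Lemma pt_eqb_false p q : pt_eqb p q = false <-> p <> q.
Proof. rewrite <- not_true_iff_false, pt_eqb_true. reflexivity. Qed.

Lemma sqrt3_half : (sqrt 3 / 2) * (sqrt 3 / 2) = 3 / 4.
Proof. pose proof (sqrt_sqrt 3 ltac:(lra)). nra. Qed.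

Ltac pt_algebra :=
  apply pt_eq; unfold rot_about, rot, vadd, vsub; simpl;
  pose proof (sqrt_sqrt 3 ltac:(lra)) as Hs; set (s := sqrt 3) in *; clearbody s;
  field [Hs].

Lemma rot_vadd u w : rot (vadd u w) = vadd (rot u) (rot w).
Proof. pt_algebra. Qed.

Lemma rot_rot u : rot u = vadd u (rot (rot u)).
Proof. pt_algebra. Qed.

Lemma rot_cube u : rot (rot (rot u)) = vsub (0, 0) u.
Proof. pt_algebra. Qed.

Lemma rot_0 : rot (0, 0) = (0, 0).
Proof. pt_algebra. Qed.

Lemma rot_eq0 u : rot u = (0, 0) -> u = (0, 0).
Proof.
  intros H. pose proof (rot_cube u) as E. rewrite H, !rot_0 in E.
  injection E; intros; apply pt_eq; simpl; lra.
Qed.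

Lemma vsub_diag u : vsub u u = (0, 0).
Proof. pt_algebra. Qed.

Lemma vsub_chain x y z : vsub z x = vadd (vsub y x) (vsub z y).
Proof. pt_algebra. Qed.

Lemma vsub_eq0 x y : vsub x y = (0, 0) -> x = y.
Proof. intros E; injection E; intros; apply pt_eq; lra. Qed.

Lemma rot_about_vsub v x : vsub (rot_about v x) v = rot (vsub x v).
Proof. pt_algebra. Qed.

Lemma rot_about_inj v x y : rot_about v x = rot_about v y -> x = y.
Proof.
  intros E. apply vsub_eq0, rot_eq0.
  apply (f_equal (fun z => vsub z (rot_about v y))) in E. rewrite vsub_diag in E.
  rewrite <- E. pt_algebra.
Qed.

(** * Half-planes and sextants *)

Definition upper (u : pt) : bool :=
  if Rlt_dec 0 (snd u) then true
  else if Rlt_dec (snd u) 0 then false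
  else if Rlt_dec 0 (fst u) then true else false.

Lemma upper_true u : upper u = true -> 0 < snd u \/ snd u = 0 /\ 0 < fst u.
Proof.
  unfold upper. destruct (Rlt_dec 0 (snd u)), (Rlt_dec (snd u) 0), (Rlt_dec 0 (fst u));
    intros H; try discriminate; lra.
Qed.

Lemma upper_false u : upper u = false -> snd u < 0 \/ snd u = 0 /\ fst u <= 0.
Proof.
  unfold upper. destruct (Rlt_dec 0 (snd u)), (Rlt_dec (snd u) 0), (Rlt_dec 0 (fst u));
    intros H; try discriminate; lra.
Qed.

Lemma upper_0 : upper (0, 0) = false.
Proof.
  destruct (upper (0, 0)) eqn:E; [|reflexivity]. apply upper_true in E; simpl in E; lra.
Qed.

Lemma upper_vadd b u w : upper u = b -> upper w = b -> upper (vadd u w) = b.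
Proof.
  destruct b; intros Hu Hw; destruct (upper (vadd u w)) eqn:E; try reflexivity; exfalso.
  - apply upper_true in Hu, Hw. apply upper_false in E. simpl in E. lra.
  - apply upper_false in Hu, Hw. apply upper_true in E. simpl in E. lra.
Qed.

Lemma upper_opp u : u <> (0, 0) -> upper (vsub (0, 0) u) = negb (upper u).
Proof.
  intros N. destruct (upper u) eqn:Hu, (upper (vsub (0, 0) u)) eqn:E; try reflexivity; exfalso.
  - apply upper_true in Hu, E. simpl in E. lra.
  - apply upper_false in Hu, E. simpl in E. apply N, pt_eq; simpl; lra.
Qed.

(** [rot u] is the sum of [u] and [rot (rot u)]. So the test patterns true, false, true and false,
    true, false never occur, which justifies the wildcards in [sextant]. *)
Lemma upper_rot b u : upper u = b -> upper (rot (rot u)) = b -> upper (rot u) = b.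
Proof. rewrite (rot_rot u) at 2. apply upper_vadd. Qed.

(* The number [i] such that the direction of [u] lies in [60 i, 60 (i + 1)) degrees, and 6 for
   [u = 0].  The three tests are for the half-open half-planes [0, 180), [-60, 120), [-120, 60). *)
Definition sextant (u : pt) : nat :=
  if pt_eqb u (0, 0) then 6
  else match upper u, upper (rot u), upper (rot (rot u)) with
       | true, true, true => 0
       | true, true, false => 1
       | true, false, _ => 2
       | false, false, false => 3
       | false, false, true => 4
       | false, true, _ => 5
       end.

(** Rotation shifts the three half-plane tests by one place; as [rot] cubed is negation, the new
    third test is the negated old first one. *)
Lemma sextant_rot i u : (i < 6)%nat -> sextant u = i -> sextant (rot u) = ((i + 1) mod 6)%nat.
Proof.
  intros Hi <-. unfold sextant in *.
  destruct (pt_eqb u (0, 0)) eqn:E; [simpl in Hi; lia|].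
  apply pt_eqb_false in E.
  destruct (pt_eqb (rot u) (0, 0)) eqn:E'; [apply pt_eqb_true, rot_eq0 in E'; contradiction|].
  rewrite rot_cube, (upper_opp u E). pose proof (upper_rot (upper u) u eq_refl) as C.
  destruct (upper u), (upper (rot u)), (upper (rot (rot u))); try reflexivity;
    now specialize (C eq_refl).
Qed.

Lemma sextant_count u :
  let c i := Nat.b2n (sextant u =? i) in
  (Nat.b2n (upper u) = c 0 + c 1 + c 2 /\
   Nat.b2n (upper (rot u)) = c 5 + c 0 + c 1 /\
   Nat.b2n (upper (rot (rot u))) = c 4 + c 5 + c 0 /\
   c 0 + c 1 + c 2 + c 3 + c 4 + c 5 = Nat.b2n (negb (pt_eqb u (0, 0)%R)))%nat.
Proof.
  cbv zeta. unfold sextant. destruct (pt_eqb u (0, 0)) eqn:E.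
  - apply pt_eqb_true in E. subst u. rewrite !rot_0, upper_0. repeat split.
  - pose proof (upper_rot (upper u) u eq_refl) as C.
    destruct (upper u), (upper (rot u)), (upper (rot (rot u))); try (repeat split);
    specialize (C eq_refl); discriminate.
Qed.

(** With [d] the squared side, [b - a] and [c - a] have inner product [d / 2] and cross product
    [s d] or [- s d]. These determine either vector from the other, and the sign is the
    orientation. *)
Lemma equilateral_rot a b c : equilateral a b c -> c = rot_about a b \/ b = rot_about a c.
Proof.
  intros [E1 E2].
  assert (S : forall p q r t, Defs.dist p q = Defs.dist r t ->
    (fst p - fst q) ^ 2 + (snd p - snd q) ^ 2 = (fst r - fst t) ^ 2 + (snd r - snd t) ^ 2).
  { intros p q r t. unfold Defs.dist. apply sqrt_inj; apply Rplus_le_le_0_compat; apply pow2_ge_0. }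
  apply S in E1, E2. clear S.
  destruct a as [a1 a2], b as [b1 b2], c as [c1 c2]. simpl in E1, E2.
  pose proof sqrt3_half as Hs. unfold rot_about, rot, vadd, vsub. simpl.
  set (s := sqrt 3 / 2) in *. clearbody s.
  set (p := b1 - a1) in *. set (q := b2 - a2) in *. set (x := c1 - a1) in *. set (y := c2 - a2) in *.
  assert (F1 : x * x + y * y = p * p + q * q) by (subst p q x y; nra).
  assert (F2 : 2 * (x * p + y * q) = p * p + q * q) by (subst p q x y; nra).
  set (d := p * p + q * q) in *.
  (* Lagrange's identity: the cross product of b - a and c - a is s d or - s d. *)
  assert (F3 : (p * y - q * x - s * d) * (p * y - q * x + s * d) = 0).
  { transitivity ((p * y - q * x) ^ 2 - (s * s) * d ^ 2); [ring|]. rewrite Hs.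
    transitivity (d * (x * x + y * y) - (x * p + y * q) ^ 2 - 3 / 4 * d ^ 2); [subst d; ring|].
    rewrite F1. replace (x * p + y * q) with (d / 2) by lra. field. }
  (* [equilateral] admits [a = b = c], the case of side 0. *)
  destruct (Req_dec d 0) as [D|D].
  - rewrite D in F1. destruct (Rplus_sqr_eq_0 _ _ D) as [P Q], (Rplus_sqr_eq_0 _ _ F1) as [X Y].
    left. apply pt_eq; simpl; rewrite P, Q; subst x y; lra.
  - apply Rmult_integral in F3. destruct F3 as [F3|F3]; [left | right]; apply pt_eq; simpl.
    (* [d (c - a)] is the inner product times [b - a] plus the cross product times [b - a] turned by
       90 degrees. *)
    + assert (d * x = d * (p / 2 - s * q)) as X%Rmult_eq_reg_l; [|subst x; lra|exact D].
      transitivity (p * (x * p + y * q) - q * (p * y - q * x)); [unfold d; ring|].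
      replace (x * p + y * q) with (d / 2) by lra.
      replace (p * y - q * x) with (s * d) by lra. field.
    + assert (d * y = d * (s * p + q / 2)) as Y%Rmult_eq_reg_l; [|subst y; lra|exact D].
      transitivity (q * (x * p + y * q) + p * (p * y - q * x)); [unfold d; ring|].
      replace (x * p + y * q) with (d / 2) by lra.
      replace (p * y - q * x) with (s * d) by lra. field.
    (* Opposite orientation: the same with [b] and [c] exchanged. *)
    + assert (d * p = d * (x / 2 - s * y)) as X%Rmult_eq_reg_l; [|subst p; lra|exact D].
      rewrite <- F1 at 2.
      transitivity (x * (x * p + y * q) + y * (p * y - q * x)); [rewrite <- F1; ring|].
      replace (x * p + y * q) with (d / 2) by lra.
      replace (p * y - q * x) with (- s * d) by lra. rewrite F1. field.
    + assert (d * q = d * (s * x + y / 2)) as Y%Rmult_eq_reg_l; [|subst q; lra|exact D].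
      rewrite <- F1 at 2.
      transitivity (y * (x * p + y * q) - x * (p * y - q * x)); [rewrite <- F1; ring|].
      replace (x * p + y * q) with (d / 2) by lra.
      replace (p * y - q * x) with (- s * d) by lra. rewrite F1. field.
Qed.

Lemma rot_about_cycle a b c : c = rot_about a b -> a = rot_about b c.
Proof. intros ->. pt_algebra. Qed.

(* Counting in the sextants around a point *)
Local Close Scope R_scope.

Definition in_sextant (V : list pt) (v : pt) (i : nat) : nat :=
  sumn (fun x => Nat.b2n (sextant (vsub x v) =? i)) V.

(** The image is a second summation variable, so that exchanging the sums counts by images. *)
Definition rotation_pairs (V : list pt) (v : pt) (i : nat) : nat :=
  sumn (fun x => sumn (fun y =>
    Nat.b2n (sextant (vsub x v) =? i) * Nat.b2n (pt_eqb y (rot_about v x))) V) V.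

Lemma rotation_pairs_le_source V v i : NoDup V -> rotation_pairs V v i <= in_sextant V v i.
Proof.
  intros D. apply sumn_le; intros x _. rewrite sumn_mul.
  rewrite <- Nat.mul_1_r. apply Nat.mul_le_mono_l, sumn_b2n_le1; [exact D|].
  intros y z Hy%pt_eqb_true Hz%pt_eqb_true. congruence.
Qed.

(** Each image [y] lies in the next sextant and has at most one preimage, rotations being
    injective. *)
Lemma rotation_pairs_le_target V v i : NoDup V -> i < 6 ->
  rotation_pairs V v i <= in_sextant V v ((i + 1) mod 6).
Proof.
  intros D Hi. unfold rotation_pairs. rewrite sumn_exchange. apply sumn_le; intros y _.
  etransitivity.
  - apply sumn_le with
      (g := fun x => Nat.b2n (sextant (vsub y v) =? (i + 1) mod 6)
                     * Nat.b2n (pt_eqb y (rot_about v x))).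
    intros x _. destruct (pt_eqb y (rot_about v x)) eqn:E; [|cbn [Nat.b2n]; lia].
    apply Nat.mul_le_mono_r. apply pt_eqb_true in E. subst y. rewrite rot_about_vsub.
    destruct (sextant (vsub x v) =? i) eqn:S; [|simpl; lia].
    apply Nat.eqb_eq in S. rewrite (sextant_rot i _ Hi S), Nat.eqb_refl. reflexivity.
  - rewrite sumn_mul, <- Nat.mul_1_r. apply Nat.mul_le_mono_l, sumn_b2n_le1; [exact D|].
    intros x z Hx%pt_eqb_true Hz%pt_eqb_true. apply (rot_about_inj v); congruence.
Qed.

(* For [k = 0, 1, 2] this is a strict total order, because [upper] is a half-plane containing
   exactly one of its two boundary rays; so [rank (above k) V] takes each value below [length V]
   exactly once. *)
Definition above (k : nat) (v w : pt) : bool := upper (Nat.iter k rot (vsub w v)).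

Lemma sumn_rank_above k f V : NoDup V ->
  sumn (fun v => f (rank (above k) V v)) V = sumn f (seq 0 (length V)).
Proof.
  intros D. unfold above. apply sumn_rank; [exact D| | |].
  - intros x. rewrite vsub_diag.
    replace (Nat.iter k rot (0, 0)%R) with ((0, 0)%R : pt); [apply upper_0|].
    induction k as [|k IH]; simpl; [reflexivity|]. rewrite <- IH. symmetry; apply rot_0.
  - intros x y z Hxy Hyz. rewrite (vsub_chain x y z).
    replace (Nat.iter k rot (vadd (vsub y x) (vsub z y)))
      with (vadd (Nat.iter k rot (vsub y x)) (Nat.iter k rot (vsub z y)));
      [now apply upper_vadd|].
    clear. induction k as [|k IH]; simpl; [reflexivity|]. now rewrite <- IH, rot_vadd.
  - intros x y Hxy Hyx. apply eq_sym, vsub_eq0.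
    assert (Opp : Nat.iter k rot (vsub x y) = vsub (0, 0)%R (Nat.iter k rot (vsub y x))).
    { clear. induction k as [|k IH]; simpl; [pt_algebra|]. rewrite IH. pt_algebra. }
    destruct (pt_eqb (Nat.iter k rot (vsub y x)) (0, 0)%R) eqn:E.
    + apply pt_eqb_true in E. clear - E.
      induction k as [|k IH]; simpl in E; [exact E|]. now apply IH, rot_eq0.
    + apply pt_eqb_false in E. rewrite Opp, (upper_opp _ E), Hxy in Hyx. discriminate.
Qed.

Lemma ranks_in_sextants V v :
  rank (above 0) V v = in_sextant V v 0 + in_sextant V v 1 + in_sextant V v 2 /\
  rank (above 1) V v = in_sextant V v 5 + in_sextant V v 0 + in_sextant V v 1 /\
  rank (above 2) V v = in_sextant V v 4 + in_sextant V v 5 + in_sextant V v 0.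
Proof.
  unfold rank, in_sextant. rewrite <- !sumn_add.
  repeat split; apply sumn_ext; intros w _; apply (sextant_count (vsub w v)).
Qed.

Lemma in_sextant_total V v : NoDup V -> In v V ->
  in_sextant V v 0 + in_sextant V v 1 + in_sextant V v 2 + in_sextant V v 3
  + in_sextant V v 4 + in_sextant V v 5 = length V - 1.
Proof.
  intros D Hv. unfold in_sextant. rewrite <- !sumn_add.
  rewrite (sumn_ext _ _ (fun w => Nat.b2n (negb (pt_eqb (vsub w v) (0, 0)%R))))
    by (intros w _; apply (sextant_count (vsub w v))).
  assert (T : sumn (fun w => Nat.b2n (negb (pt_eqb (vsub w v) (0, 0)%R))) V
            + sumn (fun w => Nat.b2n (pt_eqb (vsub w v) (0, 0)%R)) V = length V).
  { rewrite <- sumn_add, <- (Nat.mul_1_l (length V)), <- sumn_const.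
    apply sumn_ext; intros w _. destruct (pt_eqb _ _); reflexivity. }
  (* Only [v] itself is outside the six sextants, and it occurs once in [V]. *)
  enough (sumn (fun w => Nat.b2n (pt_eqb (vsub w v) (0, 0)%R)) V = 1) by lia.
  apply Nat.le_antisymm.
  - apply sumn_b2n_le1; [exact D|].
    intros x y Hx%pt_eqb_true%vsub_eq0 Hy%pt_eqb_true%vsub_eq0. congruence.
  - destruct (in_split v V Hv) as (l1 & l2 & ->). rewrite sumn_app, sumn_cons, vsub_diag.
    replace (pt_eqb (0, 0)%R (0, 0)%R) with true by (symmetry; now apply pt_eqb_true). simpl; lia.
Qed.

Lemma rotation_pairs_weight V v : NoDup V -> In v V ->
  36 * (rotation_pairs V v 0 + rotation_pairs V v 1 + rotation_pairs V v 2
        + rotation_pairs V v 3 + rotation_pairs V v 4 + rotation_pairs V v 5) <=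
  weight (length V - 1) (rank (above 0) V v) + weight (length V - 1) (rank (above 1) V v)
  + weight (length V - 1) (rank (above 2) V v).
Proof.
  intros D Hv. destruct (ranks_in_sextants V v) as (-> & -> & ->).
  pose proof (fun i => rotation_pairs_le_target V v i D) as T.
  apply sextant_bound with (s3 := in_sextant V v 3);
    [symmetry; now apply in_sextant_total | ..];
    first [ now apply rotation_pairs_le_source
          | apply (T 0) | apply (T 1) | apply (T 2) | apply (T 3) | apply (T 4) | apply (T 5) ];
    lia.
Qed.

(** * Triangles counted by rotations about their vertices *)

Definition rotated (v x y : pt) : nat :=
  Nat.b2n (negb (pt_eqb x v)) * Nat.b2n (pt_eqb y (rot_about v x)).

Lemma rotated_sextants V v :
  sumn (fun x => sumn (rotated v x) V) V <=
  rotation_pairs V v 0 + rotation_pairs V v 1 + rotation_pairs V v 2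
  + rotation_pairs V v 3 + rotation_pairs V v 4 + rotation_pairs V v 5.
Proof.
  unfold rotation_pairs. rewrite <- !sumn_add. apply sumn_le; intros x _.
  rewrite <- !sumn_add. apply sumn_le; intros y _.
  rewrite <- !Nat.mul_add_distr_r. unfold rotated. apply Nat.mul_le_mono_r.
  destruct (sextant_count (vsub x v)) as (_ & _ & _ & ->).
  destruct (pt_eqb x v) eqn:E; [simpl; lia|].
  destruct (pt_eqb (vsub x v) (0, 0)%R) eqn:E'; [|reflexivity].
  apply pt_eqb_true, vsub_eq0 in E'. apply pt_eqb_false in E. contradiction.
Qed.

(** Rotation about each vertex takes the next vertex to the remaining one; [a <> b] makes all three
    distinct. *)
Lemma rotated_cycle a b c : a <> b -> c = rot_about a b ->
  rotated a b c + rotated b c a + rotated c a b = 3.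
Proof.
  intros Hab Hc. pose proof (rot_about_cycle _ _ _ Hc) as Ha.
  pose proof (rot_about_cycle _ _ _ Ha) as Hb.
  assert (Hbc : c <> b).
  { intros E. rewrite E in Ha. apply Hab. rewrite Ha.
    unfold rot_about. rewrite vsub_diag, rot_0. pt_algebra. }
  assert (Hca : a <> c).
  { intros E. rewrite <- E in Hb. apply Hab. symmetry. rewrite Hb.
    unfold rot_about. rewrite vsub_diag, rot_0. pt_algebra. }
  assert (R : forall p q r, q <> p -> r = rot_about p q -> rotated p q r = 1).
  { intros p q r N%pt_eqb_false R%pt_eqb_true. unfold rotated. now rewrite N, R. }
  rewrite !R; auto.
Qed.

(** Excludes the one-point triples that [equilateral] accepts. *)
Lemma triples_head_neq V : NoDup V ->
  forall a b c, In (a, b, c) (triples V) -> a <> b /\ a <> c.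
Proof.
  assert (P : forall l x y, In (x, y) (pairs l) -> In x l /\ In y l).
  { induction l as [|z l IH]; simpl; [tauto|]. intros x y H. apply in_app_or in H as [H|H].
    - apply in_map_iff in H as (w & [= <- <-] & H). tauto.
    - apply IH in H. tauto. }
  induction 1 as [|z l Hz D IH]; simpl; [tauto|]. intros a b c H. apply in_app_or in H as [H|H].
  - apply in_map_iff in H as ((x & y) & [= <- <- <-] & H). apply P in H as [Hx Hy].
    simpl. split; congruence.
  - now apply IH.
Qed.

(** Among the six orderings of a triangle, the three counterclockwise ones each contribute 1. *)
Lemma triangles_rotated V : NoDup V ->
  3 * S_E V <= sumn (fun v => sumn (fun x => sumn (rotated v x) V) V) V.
Proof.
  intros D. etransitivity; [|apply triples_sumn].
  unfold S_E. rewrite length_filter_sumn, <- sumn_mul. apply sumn_le.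
  intros [[a b] c] H. apply (triples_head_neq V D) in H as [Hab Hac].
  destruct (equilateralb a b c) eqn:E; [|simpl; lia].
  apply equilateralb_spec, equilateral_rot in E as [E|E].
  - pose proof (rotated_cycle a b c Hab E). simpl; lia.
  - pose proof (rotated_cycle a c b Hac E). simpl; lia.
Qed.

Theorem theorem1 (n : nat) (hn : (1 <= n)%nat) (V : list pt)
  (hV : NoDup V) (hlen : length V = n) :
  (S_E V <= ((4 * n - 1) * (n - 1)) / 18)%nat.
Proof.
  (* The left 3 counts the vertices of a triangle, the right 3 the ranks of a point. *)
  assert (H : 36 * (3 * S_E V) <= 3 * sumn (weight (n - 1)) (seq 0 n)).
  { etransitivity; [apply Nat.mul_le_mono_l, (triangles_rotated V hV)|].
    rewrite <- sumn_mul. etransitivity.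
    - apply sumn_le; intros v Hv. etransitivity.
      + apply Nat.mul_le_mono_l, rotated_sextants.
      + apply (rotation_pairs_weight V v hV Hv).
    - rewrite !sumn_add, hlen, !sumn_rank_above, hlen by exact hV. lia. }
  (* For [N = n - 1], [8 N^2 + 6 N = 2 (4 n - 1) (n - 1)]. *)
  pose proof (sum_weight (n - 1)) as W. replace (S (n - 1)) with n in W by lia.
  apply Nat.div_le_lower_bound; [discriminate|]. nia.
Qed.
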